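(* Let $\beta_{\rm sr},\beta_{\rm sd},\beta_{\rm rd}$ be nonnegative integers, $n=\max\{\beta_{\rm sr},\beta_{\rm sd},\beta_{\rm rd}\}$, and consider the deterministic half-duplex relay channel with $X_s,X_r\in\mathbb{F}_2^n$, $S_r\in\{0,1\}$, and outputs $$Y_r=\mathbf{S}^{n-\beta_{\rm sr}}X_s(1-S_r),\qquad Y_d=\mathbf{S}^{n-\beta_{\rm sd}}X_s+\mathbf{S}^{n-\beta_{\rm rd}}X_rS_r\quad(\text{over }\mathbb{F}_2).$$ Its capacity is $$C^{\rm(HD)}=\begin{cases}\beta_{\rm sd}+\displaystyle\max_{\gamma\in[0,1]}\min\Big\{(1-\theta^*(\gamma))\log\tfrac{1}{1-\theta^*(\gamma)}+\theta^*(\gamma)\log\tfrac{L-1}{\theta^*(\gamma)},\ \gamma[\beta_{\rm sr}-\beta_{\rm sd}]^+\Big\} & \text{if }\beta_{\rm sr}>\beta_{\rm sd},\ \beta_{\rm rd}>\beta_{\rm sd},\\ \beta_{\rm sd} & \text{otherwise,}\end{cases}$$ where $\theta^*(\gamma)=1-\max\{1/L,\gamma\}$ and $L=2^{[\beta_{\rm rd}-\beta_{\rm sd}]^+}$ (with $0\log(\cdot/0):=0$).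
   Context: $\mathbf{S}$ is the $n\times n$ down-shift matrix over $\mathbb{F}_2$ (ones on the first subdiagonal, zeros elsewhere), so $\mathbf{S}^{n-\beta}X$ delivers the $\beta$ most significant bits of $X$ to the $\beta$ lowest positions. The relay chooses $(X_{r,i},S_{r,i})$ at time $i$ as a (possibly randomized) function of its past outputs $Y_r^{i-1}$; $S_r=0$ means the relay listens, $S_r=1$ means it transmits. The source maps its message to $X_s^N$, the destination decodes from $Y_d^N$; capacity is the supremum of rates (bits per channel use) with vanishing error probability. Logs base 2, $[x]^+=\max\{x,0\}$. *)

(* Defs.v *)
From Stdlib Require Import Reals.
From HB Require Import structures.
From mathcomp Require Import all_boot all_order all_algebra.
Set Implicit Arguments. Unset Strict Implicit. Unset Printing Implicit Defensive.
Import GRing.Theory.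

Definition Sig (n : nat) := 'cV['F_2]_n.

Definition shiftmx (n : nat) : 'M['F_2]_n :=
  \matrix_(i < n, j < n) ((if (i : nat) == (j : nat).+1 then (1%R : 'F_2) else (0%R : 'F_2)) : 'F_2).

Definition shiftpow (n k : nat) (x : Sig n) : Sig n :=
  iter k (fun y => (shiftmx n *m y)%R) x.

Definition nHD (bsr bsd brd : nat) : nat := maxn bsr (maxn bsd brd).

Definition Yr (bsr bsd brd : nat) (xs : Sig (nHD bsr bsd brd)) (sr : bool)
  : Sig (nHD bsr bsd brd) :=
  ((if sr then (0%R : 'F_2) else (1%R : 'F_2)) *: shiftpow (nHD bsr bsd brd - bsr) xs)%R.

Definition Yd (bsr bsd brd : nat) (xs xr : Sig (nHD bsr bsd brd)) (sr : bool)
  : Sig (nHD bsr bsd brd) :=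
  (shiftpow (nHD bsr bsd brd - bsd) xs
   + (if sr then (1%R : 'F_2) else (0%R : 'F_2)) *: shiftpow (nHD bsr bsd brd - brd) xr)%R.

(* deterministic relay strategy: at time i, maps past relay outputs
   Y_r^{i-1} (a list of length i) to (X_{r,i}, S_{r,i}) *)
Definition relay_strategy (n : nat) := nat -> seq (Sig n) -> Sig n * bool.

Fixpoint run (bsr bsd brd : nat) (xs : nat -> Sig (nHD bsr bsd brd))
  (g : relay_strategy (nHD bsr bsd brd)) (k : nat)
  : seq (Sig (nHD bsr bsd brd)) * seq (Sig (nHD bsr bsd brd)) :=
  match k with
  | 0 => ([::], [::])
  | k'.+1 =>
      let p := @run bsr bsd brd xs g k' in
      let xr := (g k' p.1).1 in
      let sr := (g k' p.1).2 in
      (rcons p.1 (@Yr bsr bsd brd (xs k') sr),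
       rcons p.2 (@Yd bsr bsd brd (xs k') xr sr))
  end.

(* A code with M messages: source encoder (message -> X_s sequence),
   a randomized relay (finite probability mixture of deterministic
   strategies), and a destination decoder from Y_d^N. *)
Record code (bsr bsd brd M : nat) := Code {
  enc : 'I_M -> nat -> Sig (nHD bsr bsd brd);
  relay : seq (R * relay_strategy (nHD bsr bsd brd));
  dec : seq (Sig (nHD bsr bsd brd)) -> 'I_M }.

Local Open Scope R_scope.

Definition valid_code bsr bsd brd M (c : code bsr bsd brd M) : Prop :=
  (forall p, List.In p (relay c) -> (0 <= p.1)) /\
  \big[Rplus/0]_(p <- relay c) p.1 = 1.

Definition Perr bsr bsd brd M (N : nat) (c : code bsr bsd brd M) : R :=
  Rmult (Rinv (INR M))
   (\big[Rplus/0]_(m < M) \big[Rplus/0]_(p <- relay c)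
      Rmult p.1 (if dec c (run (enc c m) p.2 N).2 == m then 0 else 1)).

Definition achievable (bsr bsd brd : nat) (Rt : R) : Prop :=
  forall eps : R, (0 < eps) ->
  exists N0 : nat, forall N : nat, (N0 <= N)%N ->
  exists (M : nat) (c : code bsr bsd brd M),
    valid_code c /\ (Rpower 2 (INR N * Rt) <= INR M) /\ (Perr N c <= eps).

Definition log2 (x : R) : R := (ln x / ln 2).

Definition xlog (x a : R) : R := if Req_EM_T x 0 then 0 else (x * log2 (a / x)).

Definition Lpar (bsd brd : nat) : R := INR (2 ^ (brd - bsd)).

Definition theta_star (bsd brd : nat) (g : R) : R :=
  (1 - Rmax (/ Lpar bsd brd) g).

Definition objective (bsr bsd brd : nat) (g : R) : R :=
  let t := theta_star bsd brd g in
  Rmin (xlog (1 - t) 1 + xlog t (Lpar bsd brd - 1))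
       (g * INR (bsr - bsd)).

(* Main.v *)
(* The channel is deterministic, so a randomised relay can be replaced by its
   best strategy, and a code amounts to a set of source inputs that one relay
   strategy maps to distinct destination outputs; no entropy is needed.

   With b = brd - bsd and a = bsr - bsd, the b upper output bits are the relay's
   alone, and are zero when it listens.  Among the correctly decoded messages
   for which the relay listens in exactly k of the N slots, the destination sees
   2^(bsd N) lower parts and a word over 2^b symbols with at least k zeros; the
   outputs are also determined by the bsd source bits of every slot together
   with the a hidden bits of the k listening slots.  So their number is at most
   2^(bsd N) min(#words, 2^(a k)), and there are only N + 1 values of k.

   Conversely a zero-error block scheme attains this: in each block the relay
   sends a word with at least k zeros, listening at its zeros, and the a hidden
   bits received there select its word for the next block.  Comparing with a
   binomial distribution, whose mode is its mean k, #words is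
   2^(N * entropy term at k / N) up to a factor N + 1. *)
Require Import Defs.
From Stdlib Require Import Reals Lra.
From HB Require Import structures.
From mathcomp Require Import all_boot all_order all_algebra.
From mathcomp Require Import zify.
Set Implicit Arguments. Unset Strict Implicit. Unset Printing Implicit Defensive.
Import GRing.Theory.

(** * Bits and the two channel outputs *)

(** Indexing by [nat] with default zero lets segments of signals of different lengths be compared
    without casts between ordinals. Entry 0 is the most significant bit. *)
Definition bit n (x : Sig n) (k : nat) : 'F_2 :=
  oapp (fun i : 'I_n => x i ord0) 0%R (insub k).

Definition seg n (x : Sig n) (o l : nat) : 'cV['F_2]_l :=
  (\col_(i < l) bit x (o + i))%R.

Lemma bitE n (x : Sig n) (i : 'I_n) : bit x i = x i ord0.
Proof. by rewrite /bit valK. Qed.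

Lemma bit_ge n (x : Sig n) k : n <= k -> bit x k = 0%R.
Proof. by move=> le_nk; rewrite /bit insubN // -leqNgt. Qed.

Lemma eq_bit n (x y : Sig n) : (forall k, k < n -> bit x k = bit y k) -> x = y.
Proof.
by move=> exy; apply/colP=> i; have := exy i (ltn_ord i); rewrite !bitE.
Qed.

Lemma bit_col n (f : nat -> 'F_2) k :
  bit (\col_(i < n) f i)%R k = if k < n then f k else 0%R.
Proof.
case: ltnP => [lt_kn|]; last exact: bit_ge.
by rewrite (bitE _ (Ordinal lt_kn)) mxE.
Qed.

Lemma bit_seg n (x : Sig n) o l k : bit (seg x o l) k = if k < l then bit x (o + k) else 0%R.
Proof. exact: (bit_col _ (fun i => bit x (o + i))). Qed.

Lemma bitD n (x y : Sig n) k : bit (x + y)%R k = (bit x k + bit y k)%R.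
Proof.
have [lt_kn|le_nk] := ltnP k n; last by rewrite !bit_ge // addr0.
by rewrite !(bitE _ (Ordinal lt_kn)) mxE.
Qed.

Lemma bit0 n k : bit (0 : Sig n)%R k = 0%R.
Proof.
have [lt_kn|le_nk] := ltnP k n; last by rewrite !bit_ge.
by rewrite !(bitE _ (Ordinal lt_kn)) mxE.
Qed.

Lemma bit_shiftpow n s (x : Sig n) k :
  bit (shiftpow s x) k = if (s <= k) && (k < n) then bit x (k - s) else 0%R.
Proof.
elim: s k => [|s IHs] k.
  by rewrite subn0 /=; case: ltnP => // /(bit_ge x).
have [lt_kn|le_nk] := ltnP k n; last by rewrite bit_ge // andbF.
rewrite (bitE _ (Ordinal lt_kn)) /= mxE andbT.
case: k lt_kn => [|k] lt_kn /=.
  by rewrite big1 // => j _; rewrite mxE mul0r.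
have lt_k'n : k < n by lia.
rewrite (bigD1 (Ordinal lt_k'n)) //= mxE /= eqxx mul1r big1 ?addr0.
  rewrite -(bitE _ (Ordinal lt_k'n)) /= -/(shiftpow s x) IHs ltnS lt_k'n andbT.
  by rewrite subSS.
move=> j ne_jk; rewrite mxE ifN ?mul0r //.
by apply: contra ne_jk => /eqP[ekj]; apply/eqP/val_inj.
Qed.

Lemma seg_eq_bit n m (x : Sig n) (y : Sig m) o o' l k :
  seg x o l = seg y o' l -> k < l -> bit x (o + k) = bit y (o' + k).
Proof.
move=> exy lt_kl; have := congr1 (fun z : Sig l => bit z k) exy.
by rewrite !bit_seg lt_kl.
Qed.

Lemma eq_seg n m (x : Sig n) (y : Sig m) o o' l :
  (forall k, k < l -> bit x (o + k) = bit y (o' + k)) -> seg x o l = seg y o' l.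
Proof.
by move=> exy; apply: eq_bit => k lt_kl; rewrite !bit_seg lt_kl; apply: exy.
Qed.

Lemma eq_shiftpow n m (x y : Sig n) :
  m <= n -> seg x 0 m = seg y 0 m -> shiftpow (n - m) x = shiftpow (n - m) y.
Proof.
move=> le_mn exy; apply: eq_bit => k lt_kn; rewrite !bit_shiftpow lt_kn andbT.
case: leqP => // le_k; have lt : k - (n - m) < m by lia.
exact: (seg_eq_bit exy lt).
Qed.

Lemma seg_add_eq n (x y : Sig n) o l1 l2 :
  seg x o l1 = seg y o l1 -> seg x (o + l1) l2 = seg y (o + l1) l2 ->
  seg x o (l1 + l2) = seg y o (l1 + l2).
Proof.
move=> e1 e2; apply: eq_seg => k lt_k.
have [lt_kl|le_lk] := ltnP k l1; first exact: (seg_eq_bit e1 lt_kl).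
have lt : k - l1 < l2 by lia.
by have := seg_eq_bit e2 lt; rewrite -addnA subnKC.
Qed.

Section Channel.
Variables bsr bsd brd : nat.
Let n := nHD bsr bsd brd.
Let b := brd - bsd.
Implicit Types (xs xr : Sig (nHD bsr bsd brd)) (s : bool).

Lemma le_bsr : bsr <= nHD bsr bsd brd. Proof. exact: leq_maxl. Qed.
Lemma le_bsd : bsd <= nHD bsr bsd brd.
Proof. by rewrite /nHD maxnCA leq_maxl. Qed.
Lemma le_brd : brd <= nHD bsr bsd brd.
Proof. by rewrite /nHD maxnA leq_maxr. Qed.

Lemma eq_Yd xs xs' xr s : seg xs 0 bsd = seg xs' 0 bsd -> Yd xs xr s = Yd xs' xr s.
Proof. by move=> e; rewrite /Yd (eq_shiftpow le_bsd e). Qed.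

Lemma eq_Yr xs xs' s : seg xs 0 bsd = seg xs' 0 bsd ->
  (~~ s -> seg xs bsd (bsr - bsd) = seg xs' bsd (bsr - bsd)) -> Yr xs s = Yr xs' s.
Proof.
rewrite /Yr; case: s => [_ _|e1 /(_ isT) e2]; first by rewrite !scale0r.
congr (_ *: _)%R; apply: eq_shiftpow le_bsr _; apply: eq_seg => k lt_k.
have e3 : seg xs 0 (bsd + (bsr - bsd)) = seg xs' 0 (bsd + (bsr - bsd)).
  exact: seg_add_eq.
by apply: (seg_eq_bit e3); lia.
Qed.

Lemma bit_Yd xs xr s k : k < n ->
  bit (Yd xs xr s) k =
  ((if (n - bsd <= k)%N then bit xs (k - (n - bsd)) else 0) +
   (if s && (n - brd <= k)%N then bit xr (k - (n - brd)) else 0))%R.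
Proof.
move=> lt_kn; rewrite /Yd bitD -/n !bit_shiftpow lt_kn andbT; congr (_ + _)%R.
case: s; last by rewrite scale0r bit0.
by rewrite scale1r bit_shiftpow lt_kn andbT.
Qed.

(** When [bsd < brd], the window from [n - brd] up to [n - bsd] ends just before the first position
    that the shifted source signal reaches; otherwise it is empty. *)
Lemma Yd_lower xs xr s :
  seg (Yd xs xr s) (n - brd) b = if s then seg xr 0 b else 0%R.
Proof.
have le1 := le_bsd; have le2 := le_brd; rewrite -/n in le1 le2.
apply: eq_bit => k lt_k; rewrite bit_seg lt_k; rewrite /b in lt_k.
rewrite bit_Yd; last by lia.
rewrite ifN; last by lia.
rewrite add0r leq_addr andbT; case: s; last by rewrite bit0.
by rewrite bit_seg lt_k add0n addKn.
Qed.

Lemma eq_from_Yd_segs xs xs' xr xr' s s' :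
  seg (Yd xs xr s) (n - brd) b = seg (Yd xs' xr' s') (n - brd) b ->
  seg (Yd xs xr s) (n - bsd) bsd = seg (Yd xs' xr' s') (n - bsd) bsd ->
  Yd xs xr s = Yd xs' xr' s'.
Proof.
have le1 := le_bsd; have le2 := le_brd; rewrite -/n in le1 le2.
move=> e1 e2; apply: eq_bit => k lt_k.
have [le_k|lt_k'] := leqP (n - bsd) k.
  have lt : k - (n - bsd) < bsd by lia.
  by have := seg_eq_bit e2 lt; rewrite subnKC.
have [le_k|lt_k''] := leqP (n - brd) k.
  have lt : k - (n - brd) < b by rewrite /b; lia.
  by have := seg_eq_bit e1 lt; rewrite subnKC.
(* Neither shifted signal reaches the remaining positions, so both outputs are zero there. *)
rewrite !bit_Yd //.
by rewrite !(leqNgt _ k) lt_k' lt_k'' !andbF.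
Qed.

(* The source puts [d] in the [bsd] most significant bits, which the
   destination sees, and [e] in the next ones, which only the relay sees. *)
Definition source_input (d : 'cV['F_2]_bsd) (e : 'cV['F_2]_(bsr - bsd)) : Sig n :=
  (\col_(i < n) if (i < bsd)%N then bit d i else bit e (i - bsd))%R.

Definition relay_input (u : 'cV['F_2]_(brd - bsd)) : Sig n := (\col_(i < n) bit u i)%R.

Lemma bit_source d e k : k < n ->
  bit (source_input d e) k = if k < bsd then bit d k else bit e (k - bsd).
Proof.
by move=> lt_k; rewrite (bit_col _ (fun i => if i < bsd then bit d i else bit e (i - bsd))) lt_k.
Qed.

Lemma bit_relay u k : bit (relay_input u) k = bit u k.
Proof.
rewrite (bit_col _ (bit u)); case: ltnP => // le_nk; rewrite bit_ge //.
by have := le_brd; rewrite -/n; lia.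
Qed.

(** The shift to the relay moves source entry [bsd + k] to position [n - bsr + bsd + k]. *)
Definition hidden (y : Sig n) : 'cV['F_2]_(bsr - bsd) := seg y (n - bsr + bsd) (bsr - bsd).

Lemma hidden0 : hidden 0%R = 0%R.
Proof. by apply: eq_bit => k lt_k; rewrite bit_seg lt_k !bit0. Qed.

Lemma hidden_Yr d e s : hidden (Yr (source_input d e) s) = if s then 0%R else e.
Proof.
rewrite /Yr; case: s; first by rewrite scale0r hidden0.
rewrite scale1r; apply: eq_bit => k lt_k; rewrite bit_seg lt_k -/n bit_shiftpow.
have le := le_bsr; rewrite -/n in le.
rewrite ifT; last by lia.
rewrite bit_source; last by lia.
by rewrite ifN; [congr (bit _ _)|]; lia.
Qed.

Lemma Yd_source_inj d d' e e' u u' s s' :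
  Yd (source_input d e) (relay_input u) s = Yd (source_input d' e') (relay_input u') s' ->
  d = d' /\ (if s then u else 0%R) = (if s' then u' else 0%R).
Proof.
have le1 := le_bsd; have le2 := le_brd; rewrite -/n in le1 le2.
have hd w : seg (relay_input w) 0 b = w.
  by apply: eq_bit => k lt_k; rewrite bit_seg lt_k bit_relay.
move=> eY; have := congr1 (fun y => seg y (n - brd) b) eY.
rewrite !Yd_lower !hd => eu; split=> //; apply: eq_bit => k lt_k.
have lt_n : n - bsd + k < n by lia.
have := congr1 (fun y => bit y (n - bsd + k)) eY.
rewrite !bit_Yd // leq_addr !addKn !bit_source; try lia.
rewrite lt_k !bit_relay.
(* At this position relay bit [c] may overlap the source bit. The effective relay inputs agree by
   [eu], so the overlap cancels. *)
set c := (n - bsd + k - (n - brd)).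
set t := n - brd <= n - bsd + k.
suff -> : (if s && t then bit u c else 0%R) = (if s' && t then bit u' c else 0%R).
  by move/addIr.
have := congr1 (fun y : 'cV['F_2]_(brd - bsd) => bit y c) eu.
by case: t; case: s {eY eu}; case: s'; rewrite ?bit0 // => ->.
Qed.

End Channel.

(** * Counting the outputs of a run *)

(* The zero symbol stands for a slot in which the relay listens. *)
Definition words (b T k : nat) : {set {ffun 'I_T -> 'cV['F_2]_b}} :=
  [set u : {ffun 'I_T -> 'cV['F_2]_b} | k <= #|[set i | u i == 0%R]|].

Definition block_card (a b T k : nat) : nat := minn #|words b T k| (2 ^ (a * k)).

Lemma card_F2col m : #|{: 'cV['F_2]_m}| = 2 ^ m.
Proof. by rewrite card_mx card_Fp // muln1. Qed.

Lemma nth_map_filter_iota (A : Type) (x0 : A) (f : nat -> A) (P : pred nat) N i :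
  i < N -> P i ->
  nth x0 [seq f j | j <- iota 0 N & P j] (count P (iota 0 i)) = f i.
Proof.
move=> lt_iN Pi; have -> : N = i + (N - i.+1).+1 by lia.
rewrite iotaD filter_cat map_cat nth_cat size_map size_filter ltnn subnn.
by rewrite add0n /= Pi.
Qed.

Section Run.
Variables bsr bsd brd : nat.
Let n := nHD bsr bsd brd.
Implicit Types (xs : nat -> Sig (nHD bsr bsd brd)) (g : relay_strategy (nHD bsr bsd brd)).

Definition relay_out xs g i := g i (run xs g i).1.
Definition listens xs g i := ~~ (relay_out xs g i).2.

Lemma run1S xs g k : (run xs g k.+1).1 = rcons (run xs g k).1 (Yr (xs k) (relay_out xs g k).2).
Proof. by []. Qed.

Lemma run2S xs g k : (run xs g k.+1).2 =
  rcons (run xs g k).2 (Yd (xs k) (relay_out xs g k).1 (relay_out xs g k).2).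
Proof. by []. Qed.

Lemma size_run xs g k : size (run xs g k).1 = k /\ size (run xs g k).2 = k.
Proof.
elim: k => [//|k [IH1 IH2]].
by rewrite run1S run2S !size_rcons IH1 IH2.
Qed.

Lemma nth_run2 xs g k i : i < k ->
  nth 0%R (run xs g k).2 i = Yd (xs i) (relay_out xs g i).1 (relay_out xs g i).2.
Proof.
elim: k => // k IH; rewrite ltnS run2S nth_rcons (size_run _ _ _).2 => le_ik.
case: ltnP => [/IH//|le_ki]; have -> : i = k by lia.
by rewrite eqxx.
Qed.

Definition listened xs g N : seq 'cV['F_2]_(bsr - bsd) :=
  [seq seg (xs i) bsd (bsr - bsd) | i <- iota 0 N & listens xs g i].

(** Induction on time: equal pasts give equal relay actions, hence the same listening slots so far.
    A listening slot then occupies the same place in both [listened] lists, which yields its hidden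
    bits. *)
Lemma eq_run xs xs' g N :
  (forall i, i < N -> seg (xs i) 0 bsd = seg (xs' i) 0 bsd) ->
  listened xs g N = listened xs' g N -> run xs g N = run xs' g N.
Proof.
(* All earlier prefixes are kept in the induction, since the place of slot [i] in the list depends
   on every earlier action. *)
move=> ed el; suff H i : i <= N -> forall j, j <= i -> run xs g j = run xs' g j.
  exact: (H N).
elim: i => [|i IH] lt_iN j; first by rewrite leqn0 => /eqP->.
rewrite leq_eqVlt ltnS => /orP[/eqP->{j}|]; last by apply: IH; lia.
have {}IH := IH (ltnW lt_iN).
have er j : j <= i -> relay_out xs g j = relay_out xs' g j.
  by move=> le_ji; rewrite /relay_out IH.
have eh : listens xs g i -> seg (xs i) bsd (bsr - bsd) = seg (xs' i) bsd (bsr - bsd).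
  move=> Li; have Li' : listens xs' g i by rewrite /listens -er.
  have <- := nth_map_filter_iota 0%R (fun i => seg (xs i) bsd (bsr - bsd)) lt_iN Li.
  have <- := nth_map_filter_iota 0%R (fun i => seg (xs' i) bsd (bsr - bsd)) lt_iN Li'.
  rewrite -/(listened xs g N) -/(listened xs' g N) el; congr (nth _ _ _).
  apply: eq_in_count => j; rewrite mem_iota => /andP[_ lt_j].
  by rewrite /listens er // ltnW.
have e1 : (run xs g i.+1).1 = (run xs' g i.+1).1.
  by rewrite !run1S IH // er //; congr rcons; apply: eq_Yr => [|h]; rewrite ?ed ?eh // /listens er.
have e2 : (run xs g i.+1).2 = (run xs' g i.+1).2.
  by rewrite !run2S IH // er //; congr rcons; apply: eq_Yd; rewrite ed.
by rewrite (surjective_pairing (run xs _ _)) e1 e2 -surjective_pairing.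
Qed.

Section Converse.
Variables (M N : nat) (enc : 'I_M -> nat -> Sig (nHD bsr bsd brd)).
Variables (g : relay_strategy (nHD bsr bsd brd)) (k : nat) (G : {set 'I_M}).
Hypothesis inj_G : {in G &, injective (fun m => (run (enc m) g N).2)}.
Hypothesis listens_G : {in G, forall m, count (listens (enc m) g) (iota 0 N) = k}.

Lemma card_le_listened : #|G| <= 2 ^ (bsd * N) * 2 ^ ((bsr - bsd) * k).
Proof.
pose f m := ([ffun i : 'I_N => seg (enc m i) 0 bsd],
             [ffun q : 'I_k => nth 0%R (listened (enc m) g N) q]).
have injf : {in G &, injective f}.
  move=> m m' Gm Gm' [/ffunP ed /ffunP el]; apply: inj_G => //.
  congr (_.2); apply: eq_run => [i lt_i|].
    by have := ed (Ordinal lt_i); rewrite !ffunE.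
  have sz m1 : m1 \in G -> size (listened (enc m1) g N) = k.
    by move=> G1; rewrite size_map size_filter listens_G.
  apply: (@eq_from_nth _ 0%R) => [|q]; first by rewrite !sz.
  by rewrite sz // => lt_q; have := el (Ordinal lt_q); rewrite !ffunE.
rewrite -(card_in_imset injf); apply: leq_trans (max_card _) _.
by rewrite card_prod !card_ffun !card_ord !card_F2col -!expnM.
Qed.

Lemma card_le_words : #|G| <= 2 ^ (bsd * N) * #|words (brd - bsd) N k|.
Proof.
pose y m i := Yd (enc m i) (relay_out (enc m) g i).1 (relay_out (enc m) g i).2.
pose f m := ([ffun i : 'I_N => seg (y m i) (n - bsd) bsd],
             [ffun i : 'I_N => seg (y m i) (n - brd) (brd - bsd)]).
have injf : {in G &, injective f}.
  move=> m m' Gm Gm' [/ffunP ed /ffunP el]; apply: inj_G => //.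
  apply: (@eq_from_nth _ 0%R) => [|i]; first by rewrite !(size_run _ _ _).2.
  rewrite (size_run _ _ _).2 => lt_i; rewrite !nth_run2 //.
  apply: eq_from_Yd_segs.
    by have := el (Ordinal lt_i); rewrite !ffunE.
  by have := ed (Ordinal lt_i); rewrite !ffunE.
rewrite -(card_in_imset injf).
(* By [Yd_lower] each of the [k] listening slots puts a zero into the second component of [f m]. *)
have sub : f @: G \subset setX setT (words (brd - bsd) N k).
  apply/subsetP=> _ /imsetP[m Gm ->]; rewrite !inE /= -(listens_G Gm).
  rewrite -{1}(val_enum_ord N) count_map -size_filter cardE.
  apply: uniq_leq_size => [|i]; first by rewrite filter_uniq ?enum_uniq.
  rewrite mem_filter mem_enum => /andP[/= Li _]. rewrite mem_enum inE /f /= ffunE.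
  by rewrite /y Yd_lower (negPf Li).
apply: leq_trans (subset_leq_card sub) _.
by rewrite cardsX cardsT card_ffun card_ord card_F2col -expnM.
Qed.

End Converse.

(** Pigeonhole: [G] splits into [N.+1] classes by the number of listening slots, and [k] is taken
    from a largest class. *)
Lemma converse_count (M N : nat) (enc : 'I_M -> nat -> Sig (nHD bsr bsd brd))
    (g : relay_strategy (nHD bsr bsd brd)) (G : {set 'I_M}) :
  {in G &, injective (fun m => (run (enc m) g N).2)} ->
  exists2 k, k <= N &
    #|G| <= N.+1 * (2 ^ (bsd * N) * block_card (bsr - bsd) (brd - bsd) N k).
Proof.
move=> inj_G; pose kk m := count (listens (enc m) g) (iota 0 N).
have lt_kk m : kk m < N.+1 by rewrite ltnS -[leqRHS](size_iota 0) count_size.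
pose Gk (k : 'I_N.+1) := [set m in G | kk m == k].
have [k _ kmax] := @arg_maxnP _ ord0 xpredT (fun k => #|Gk k|) isT.
exists (k : nat); first by rewrite -ltnS.
have le_Gk : #|Gk k| <= 2 ^ (bsd * N) * block_card (bsr - bsd) (brd - bsd) N k.
  have inj_Gk : {in Gk k &, injective (fun m => (run (enc m) g N).2)}.
    by move=> m m' /setIdP[Gm _] /setIdP[Gm' _]; apply: inj_G.
  have kGk : {in Gk k, forall m, kk m = k} by move=> m /setIdP[_ /eqP].
  by rewrite /block_card minnMr leq_min (card_le_words inj_Gk kGk) (card_le_listened inj_Gk kGk).
apply: leq_trans (leq_mul (leqnn N.+1) le_Gk).
rewrite -sum1_card (partition_big (fun m => Ordinal (lt_kk m)) xpredT) //=.
apply: (@leq_trans (\sum_(j < N.+1) #|Gk k|)); last by rewrite sum_nat_const card_ord.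
apply: leq_sum => j _; rewrite sum1_card; apply: leq_trans (kmax j isT).
by apply: subset_leq_card; apply/subsetP => m /andP[Gm /eqP<-]; rewrite inE Gm /=.
Qed.

End Run.

(** * Words with at least [k] zeros *)

Lemma prod_if_const (I : finType) (P : pred I) (x y : nat) :
  \prod_(i : I) (if P i then x else y) = x ^ #|P| * y ^ (#|I| - #|P|).
Proof.
rewrite (bigID P) /= (eq_bigr (fun=> x)) => [|i ->] //.
rewrite [X in _ * X](eq_bigr (fun=> y)) => [|i /negPf->] //.
rewrite !prod_nat_const -(cardC P) addKn; congr (x ^ _ * y ^ _).
Qed.

(* The words with at least [k] zeros are weighted by the product distribution
   giving mass [k / N] to zero and spreading the rest evenly; the hypothesis
   makes zero the likeliest symbol. *)
Lemma card_words_le b N k : k <= N -> N <= k * 2 ^ b ->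
  #|words b N k| * ((k * (2 ^ b).-1) ^ k * (N - k) ^ (N - k)) <= (N * (2 ^ b).-1) ^ N.
Proof.
move=> le_kN le_N; set l := (2 ^ b).-1.
have eL : 2 ^ b = l.+1 by rewrite /l prednK // expn_gt0.
(* These are the probabilities [k / N] and [(N - k) / (N * l)] scaled by [N * l], so that all
   weights are natural numbers. *)
pose q (v : 'cV['F_2]_b) := if v == 0%R then k * l else N - k.
have sumq : \sum_v q v = N * l.
  rewrite (bigD1 0%R) //= {1}/q eqxx (eq_bigr (fun=> N - k)).
    rewrite sum_nat_const; have -> : #|(fun v : 'cV['F_2]_b => v != 0%R)| = l.
      by rewrite /l -card_F2col -(cardC1 (0%R : 'cV['F_2]_b)); apply: eq_card.
    by rewrite mulnC -mulnDr subnKC // mulnC.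
  by move=> v /negPf; rewrite /q => ->.
have -> : (N * l) ^ N = \sum_(u : {ffun 'I_N -> 'cV['F_2]_b}) \prod_i q (u i).
  rewrite -(bigA_distr_bigA (fun _ v => q v)) /= sumq.
  by rewrite prod_nat_const card_ord.
rewrite -sum_nat_const.
apply: (@leq_trans (\sum_(u in words b N k) \prod_i q (u i))).
  apply: leq_sum => u; rewrite inE => le_ku; rewrite prod_if_const card_ord.
  have -> : #|(fun i => u i == 0%R)| = #|[set i | u i == 0%R]| by rewrite cardsE.
  set z := #|_| in le_ku *.
  have le_zN : z <= N by rewrite -[leqRHS](card_ord N) max_card.
  have -> : (N - k) ^ (N - k) = (N - k) ^ (N - z) * (N - k) ^ (z - k).
    by rewrite -expnD; congr (_ ^ _); lia.
  have -> : (k * l) ^ z = (k * l) ^ k * (k * l) ^ (z - k) by rewrite -expnD subnKC.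
  (* Each zero beyond the [k]-th trades a factor [N - k] for [k * l], which is no smaller because
     [N <= k * l.+1]. *)
  have : (N - k) ^ (z - k) <= (k * l) ^ (z - k).
    by case: (z - k) => // m; rewrite leq_exp2r // eL in le_N *; nia.
  move: (_ ^ (z - k)) => A; move: (_ ^ (z - k)) => B; move: (_ ^ (N - z)) => C.
  move: (_ ^ k) => D le_AB; by rewrite -!mulnA leq_mul2l mulnC leq_mul2r le_AB !orbT.
rewrite [leqRHS](bigID (mem (words b N k))) /=; exact: leq_addr.
Qed.

Lemma card_words_le_all b N k : #|words b N k| <= 2 ^ (b * N).
Proof. by apply: leq_trans (max_card _) _; rewrite card_ffun card_ord card_F2col expnM. Qed.

(** The ratio of consecutive terms is [(N - j) * k] over [j.+1 * (N - k)]: at least 1 for [j < k]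
    and at most 1 for [j >= k]. In [step] the common factor [A] replaces the division. *)
Lemma binomial_mode N k j : k <= N -> j <= N ->
  'C(N, j) * (k ^ j * (N - k) ^ (N - j)) <= 'C(N, k) * (k ^ k * (N - k) ^ (N - k)).
Proof.
move=> le_kN; pose t j := 'C(N, j) * (k ^ j * (N - k) ^ (N - j)).
have step j' : j' < N -> exists A,
    j'.+1 * t j' = A * (j'.+1 * (N - k)) /\ j'.+1 * t j'.+1 = A * ((N - j') * k).
  move=> lt_jN; exists ('C(N, j') * (k ^ j' * (N - k) ^ (N - j'.+1))); split.
    rewrite /t; have -> : N - j' = (N - j'.+1).+1 by lia.
    by rewrite expnS; move: 'C(N, j') (k ^ j') ((N - k) ^ _) => *; lia.
  rewrite /t mulnA mul_bin_left expnS.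
  by move: 'C(N, j') (k ^ j') ((N - k) ^ _) => *; lia.
have up m : m <= k -> t (k - m) <= t k.
  elim: m => [|m IH] lt_m; first by rewrite subn0.
  apply: leq_trans (IH (ltnW lt_m)).
  have /step[A []] : k - m.+1 < N by lia.
  have -> : (k - m.+1).+1 = k - m by lia.
  move=> e1 e2; rewrite -(@leq_pmul2l (k - m)); last by lia.
  by rewrite e1 e2 leq_mul2l; apply/orP; right; nia.
have down m : k + m <= N -> t (k + m) <= t k.
  elim: m => [|m IH] lt_m; first by rewrite addn0.
  apply: leq_trans (IH _); last by lia.
  have /step[A []] : k + m < N by lia.
  move=> e1 e2; rewrite addnS -(@leq_pmul2l (k + m).+1); last by lia.
  by rewrite e1 e2 leq_mul2l; apply/orP; right; nia.
rewrite -/(t j) -/(t k) => le_jN; have [le_jk|lt_kj] := leqP j k.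
  by rewrite -(subKn le_jk) up // leq_subr.
by rewrite -(subnKC (ltnW lt_kj)) down //; lia.
Qed.

(** Expand [((N - k) + k) ^ N]: none of the [N.+1] terms exceeds the mode. *)
Lemma expn_le_mode N k : k <= N ->
  N ^ N <= N.+1 * ('C(N, k) * (k ^ k * (N - k) ^ (N - k))).
Proof.
move=> le_kN; rewrite -{1}(subnK le_kN) expnDn.
rewrite -[in leqRHS](card_ord N.+1) -sum_nat_const; apply: leq_sum => j _.
by rewrite [X in _ * X]mulnC binomial_mode // -ltnS.
Qed.

(** Words with exactly [k] zeros: choose the set of zeros, then a nonzero symbol at every other
    place. *)
Lemma card_words_ge_bin b N k : k <= N -> 'C(N, k) * (2 ^ b).-1 ^ (N - k) <= #|words b N k|.
Proof.
move=> le_kN; pose zeros (u : {ffun 'I_N -> 'cV['F_2]_b}) := [set i | u i == 0%R].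
pose exact_words := [set u : {ffun 'I_N -> 'cV['F_2]_b} | #|zeros u| == k].
apply: (@leq_trans #|exact_words|); last first.
  by apply: subset_leq_card; apply/subsetP=> u; rewrite !inE => /eqP<-.
rewrite -[in leqRHS]sum1_card.
rewrite (partition_big zeros [pred Z : {set 'I_N} | #|Z| == k]) /=; last first.
  by move=> u; rewrite inE.
have <- : #|[set Z : {set 'I_N} | #|Z| == k]| = 'C(N, k) by rewrite card_draws card_ord.
rewrite -sum_nat_const; rewrite (eq_bigl (fun Z : {set 'I_N} => #|Z| == k)); last first.
  by move=> Z; rewrite inE.
apply: leq_sum => Z /eqP cZ; rewrite sum1_card.
pose F i : pred 'cV['F_2]_b := if i \in Z then pred1 0%R else predC1 0%R.
have cF : #|family F| = (2 ^ b).-1 ^ (N - k).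
  rewrite card_family foldrE big_map big_enum /=.
  rewrite (eq_bigr (fun i => if i \in Z then 1 else (2 ^ b).-1)); last first.
    by move=> i _; rewrite /F; case: ifP => _; rewrite ?card1 // cardC1 card_F2col.
  by rewrite prod_if_const exp1n mul1n card_ord cZ.
rewrite -cF; apply: subset_leq_card; apply/subsetP=> u /familyP uF.
have eZ : zeros u = Z.
  apply/setP=> i; rewrite inE; have := uF i; rewrite /F; case: (i \in Z) => //=.
  by rewrite inE => /negPf.
by rewrite unfold_in /= inE eZ cZ !eqxx.
Qed.

(** With [card_words_le_entropy] this brackets the number of words. For [0 < k] and [0 < b],
    [ent_pow] identifies the ratio of the powers involved as [2 ^ (N * ent)] at [k / N]. *)
Lemma card_words_ge b N k : k <= N ->
  N ^ N * (2 ^ b).-1 ^ (N - k) <= N.+1 * (#|words b N k| * (k ^ k * (N - k) ^ (N - k))).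
Proof.
move=> le_kN; have le_W := card_words_ge_bin b le_kN.
apply: leq_trans (leq_mul (expn_le_mode le_kN) (leqnn _)) _.
rewrite -!mulnA leq_mul2l; apply/orP; right.
apply: leq_trans (leq_mul le_W (leqnn _)); apply/eq_leq.
by move: (_ ^ k) (2 ^ b).-1 => X l; move: (l ^ _) ((N - k) ^ _) 'C(N, k) => *; lia.
Qed.

Lemma predn_exp2_gt0 b : 0 < b -> 0 < (2 ^ b).-1.
Proof.
move=> b_gt0; have : 2 ^ 1 <= 2 ^ b by rewrite leq_exp2l.
lia.
Qed.

Lemma card_words_le_entropy b N k : 0 < b -> k <= N -> N <= k * 2 ^ b ->
  #|words b N k| * (k ^ k * (N - k) ^ (N - k)) <= N ^ N * (2 ^ b).-1 ^ (N - k).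
Proof.
move=> b_gt0 le_kN le_N; have := card_words_le le_kN le_N.
have l_gt0 := predn_exp2_gt0 b_gt0.
move: (2 ^ b).-1 l_gt0 => l l_gt0; rewrite !expnMn => le_W.
have elN : l ^ N = l ^ (N - k) * l ^ k by rewrite -expnD subnK.
rewrite -(@leq_pmul2r (l ^ k)) ?expn_gt0 ?l_gt0 // -[leqRHS]mulnA -elN.
apply: leq_trans le_W; rewrite -mulnA leq_mul2l; apply/orP; right.
by rewrite mulnAC.
Qed.

(** * The block scheme *)

Lemma nth_run1 bsr bsd brd (xs : nat -> Sig (nHD bsr bsd brd)) g k i : i < k ->
  nth 0%R (run xs g k).1 i = Yr (xs i) (relay_out xs g i).2.
Proof.
elim: k => // k IH; rewrite ltnS run1S nth_rcons (size_run _ _ _).1 => le_ik.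
case: ltnP => [/IH//|le_ki]; have -> : i = k by lia.
by rewrite eqxx.
Qed.

Section Scheme.
Variables (bsr bsd brd T k : nat).
Hypotheses (T_gt0 : 0 < T) (le_kT : k <= T).
Let K := block_card (bsr - bsd) (brd - bsd) T k.

(** The default is the zero word, so an index out of range also gives at least [k] listening
    slots. *)
Definition word (m : nat) : {ffun 'I_T -> 'cV['F_2]_(brd - bsd)} :=
  nth [ffun=> 0%R] (enum (words (brd - bsd) T k)) m.

Definition slots (m : nat) : {set 'I_T} := [set p | word m p == 0%R].

(** What the source can tell the relay while word [m] is sent: hidden bits supported on its zeros.
    The position of a pattern in this list is the index of the next word. *)
Definition patterns (m : nat) : seq {ffun 'I_T -> 'cV['F_2]_(bsr - bsd)} :=
  enum (pffun_on 0%R (mem (slots m)) predT).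

Definition pattern (m l : nat) := nth [ffun=> 0%R] (patterns m) l.

Definition slot (i : nat) : 'I_T := Ordinal (ltn_pmod i T_gt0).

(* Index of the word sent in the [j]-th block: it is read off the hidden bits
   received in the listening slots of block [j - 1]. *)
Fixpoint state (j : nat) (past : seq (Sig (nHD bsr bsd brd))) : nat :=
  if j is j'.+1 then
    index [ffun p : 'I_T => hidden (nth 0%R past (j' * T + p))] (patterns (state j' past))
  else 0.

Definition block_relay : relay_strategy (nHD bsr bsd brd) := fun i past =>
  let u := word (state (i %/ T) past) (slot i) in (relay_input bsr u, u != 0%R).

Lemma card_slots m : k <= #|slots m|.
Proof.
rewrite /slots /word.
have [lt_m|le_m] := ltnP m (size (enum (words (brd - bsd) T k))).
  by have := mem_nth [ffun=> 0%R] lt_m; rewrite mem_enum inE.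
rewrite (nth_default _ le_m).
suff -> : [set p | [ffun=> 0%R] p == 0%R :> 'cV['F_2]_(brd - bsd)] = [set: 'I_T].
  by rewrite cardsT card_ord.
by apply/setP=> p; rewrite !inE ffunE eqxx.
Qed.

Lemma size_patterns m : 2 ^ ((bsr - bsd) * k) <= size (patterns m).
Proof.
rewrite -cardE card_pffun_on card_F2col -expnM leq_exp2l // leq_mul2l.
by rewrite card_slots orbT.
Qed.

Lemma pattern_off m l p : p \notin slots m -> pattern m l p = 0%R.
Proof.
move=> pN; rewrite /pattern; have [lt_l|le_l] := ltnP l (size (patterns m)).
  have := mem_nth [ffun=> 0%R] lt_l; rewrite mem_enum => /pffun_onP[sub _].
  by apply/eqP; apply: contraNT pN => nz; apply: (subsetP sub).
by rewrite (nth_default _ le_l) ffunE.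
Qed.

Section Message.
Variables (d : nat -> 'cV['F_2]_bsd) (mi : nat -> nat).
Hypotheses (mi0 : mi 0 = 0) (lt_mi : forall j, mi j < 2 ^ ((bsr - bsd) * k)).

Definition block_input (i : nat) : Sig (nHD bsr bsd brd) :=
  source_input brd (d i) (pattern (mi (i %/ T)) (mi (i %/ T).+1) (slot i)).

(** The outer induction on time says that the relay sent, and listened, as planned in every slot of
    block [j]. The inner induction on blocks gives the list of patterns in which to look up what it
    received. *)
Lemma state_run i j : j * T <= i -> state j (run block_input block_relay i).1 = mi j.
Proof.
elim/ltn_ind: i j => i IHi; elim=> [//|j IHj] le_ji /=.
rewrite IHj; last by nia.
have -> : [ffun p : 'I_T => hidden (nth 0%R (run block_input block_relay i).1 (j * T + p))]
    = pattern (mi j) (mi j.+1).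
  apply/ffunP=> p; rewrite ffunE.
  have lt_q : j * T + p < i by have := ltn_ord p; nia.
  have eq_q : (j * T + p) %/ T = j by rewrite divnMDl // divn_small ?addn0.
  have ep : slot (j * T + p) = p by apply: val_inj; rewrite /= modnMDl modn_small.
  rewrite nth_run1 // /relay_out /block_relay /= IHi //; last exact: leq_trunc_div.
  (* In a transmitting slot the relay receives zero, and the pattern is zero there too. *)
  rewrite hidden_Yr eq_q ep; case: ifP => // nz.
  by rewrite pattern_off // inE nz.
by rewrite index_uniq ?enum_uniq // (leq_trans (lt_mi _)) // size_patterns.
Qed.

Lemma nth_block_run N i : i < N ->
  nth 0%R (run block_input block_relay N).2 i =
  Yd (block_input i) (relay_input bsr (word (mi (i %/ T)) (slot i)))
    (word (mi (i %/ T)) (slot i) != 0%R).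
Proof.
move=> lt_iN; rewrite nth_run2 // /relay_out /block_relay.
by rewrite state_run // leq_trunc_div.
Qed.

End Message.

(** Block 0 sends the fixed word 0, as the relay has heard nothing yet; [s] steers blocks 1 to [B],
    and later blocks fall back to 0. *)
Definition indices B (s : {ffun 'I_B -> 'I_K}) (j : nat) : nat :=
  if j is j'.+1 then oapp (fun i => s i : nat) 0 (insub j') else 0.

Lemma lt_indices B (s : {ffun 'I_B -> 'I_K}) j : indices s j < 2 ^ ((bsr - bsd) * k).
Proof.
case: j => [|j] /=; first by rewrite expn_gt0.
case: insubP => [i _ _|_] /=; last by rewrite expn_gt0.
by apply: leq_trans (ltn_ord _) _; apply: geq_minr.
Qed.

Lemma block_code B N : B.+1 * T <= N ->
  exists (g : relay_strategy (nHD bsr bsd brd))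
         (enc : 'I_(2 ^ (bsd * N) * K ^ B) -> nat -> Sig (nHD bsr bsd brd)),
    injective (fun m => (run (enc m) g N).2).
Proof.
move=> le_BN; have lt_q (j : 'I_B) (p : 'I_T) : j.+1 * T + p < N.
  apply: leq_trans le_BN; rewrite [B.+1 * T]mulSn addnC -addSn leq_add //.
  by rewrite leq_mul2r ltn_ord orbT.
pose Lab := ({ffun 'I_N -> 'cV['F_2]_bsd} * {ffun 'I_B -> 'I_K})%type.
have <- : #|{: Lab}| = 2 ^ (bsd * N) * K ^ B.
  by rewrite card_prod !card_ffun !card_ord card_F2col expnM.
pose dd (l : Lab) i := oapp l.1 0%R (insub i).
exists block_relay, (fun m => let l := enum_val m in block_input (dd l) (indices l.2)).
suff inj : injective (fun l : Lab => (run (block_input (dd l) (indices l.2)) block_relay N).2).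
  by move=> m m' e; apply/enum_val_inj/inj.
move=> [d s] [d' s'] /= eY.
have H i : i < N -> dd (d, s) i = dd (d', s') i /\
    word (indices s (i %/ T)) (slot i) = word (indices s' (i %/ T)) (slot i).
  move=> lt_iN; have := congr1 (fun y => nth 0%R y i) eY.
  rewrite (nth_block_run _ _ (lt_indices s) lt_iN) //.
  rewrite (nth_block_run _ _ (lt_indices s') lt_iN) //.
  move=> /Yd_source_inj[-> eu]; split=> //.
  (* The relay listens exactly when its symbol is zero, so the effective input is the symbol
     itself. *)
  by move: eu; do 2!case: (altP (_ =P _)) => [->|_].
congr (_, _); apply/ffunP.
  by move=> i; have [] := H i (ltn_ord i); rewrite /dd !valK.
move=> j; have e : word (s j) = word (s' j).
  apply/ffunP=> p; have [_] := H _ (lt_q j p).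
  rewrite divnMDl // divn_small // addn0 /= !valK /=.
  have -> // : slot (j.+1 * T + p) = p.
  by apply: val_inj; rewrite /= modnMDl modn_small.
have lt_w (r : 'I_K) : r < size (enum (words (brd - bsd) T k)).
  by rewrite -cardE; apply: leq_trans (ltn_ord r) (geq_minl _ _).
apply/val_inj/eqP; rewrite /=.
have <- := nth_uniq [ffun=> 0%R] (lt_w (s j)) (lt_w (s' j)) (enum_uniq _).
by apply/eqP.
Qed.

End Scheme.

(** * Error probability *)

Local Open Scope R_scope.

HB.instance Definition _ := Monoid.isComLaw.Build R 0 Rplus
  (fun x y z => esym (Rplus_assoc x y z)) Rplus_comm Rplus_0_l.

Lemma sum_indicator (I : finType) (P : pred I) :
  \big[Rplus/0]_(i : I) (if P i then 0 else 1) = INR #|[predC P]|.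
Proof.
rewrite -sum1_card (big_mkcond (predC P)) /=.
elim/big_rec2: _ => [//|i m r _ ->]; rewrite /=.
by case: (P i); rewrite ?plus_INR /=; lra.
Qed.

(** With [e] an error indicator: if every strategy errs on at least [X] messages, so does the
    mixture on average. *)
Lemma le_weighted_sum (I : finType) (A : Type) (s : seq A) (w : A -> R) (e : I -> A -> R) X :
  (forall p, List.In p s -> 0 <= w p) ->
  (forall p, List.In p s -> X <= \big[Rplus/0]_(i : I) e i p) ->
  X * \big[Rplus/0]_(p <- s) w p
    <= \big[Rplus/0]_(i : I) \big[Rplus/0]_(p <- s) (w p * e i p).
Proof.
elim: s => [|p s IH] w_ge0 e_ge.
  by rewrite big_nil big1 => [|i _]; rewrite ?big_nil //; lra.
rewrite big_cons (eq_bigr (fun i => w p * e i p + \big[Rplus/0]_(p <- s) (w p * e i p))).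
  have -> : \big[Rplus/0]_(i : I) (w p * e i p + \big[Rplus/0]_(p0 <- s) (w p0 * e i p0)) =
    w p * \big[Rplus/0]_(i : I) e i p
      + \big[Rplus/0]_(i : I) \big[Rplus/0]_(p <- s) (w p * e i p).
    rewrite big_split; congr (_ + _).
    by rewrite (big_morph (Rmult (w p)) (Rmult_plus_distr_l _) (Rmult_0_r _)).
  have H1 := IH (fun q Hq => w_ge0 q (or_intror Hq)) (fun q Hq => e_ge q (or_intror Hq)).
  have H2 := e_ge p (or_introl erefl); have H3 := w_ge0 p (or_introl erefl).
  have := Rmult_le_compat_l _ _ _ H3 H2; lra.
by move=> i _; rewrite big_cons.
Qed.

Lemma In_not_all (A : Type) (s : seq A) (P : A -> bool) :
  ~ (forall p, List.In p s -> P p) -> exists p, ~~ P p.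
Proof.
elim: s => [[]//|p s IH] H; case Pp: (P p); last by exists p; rewrite Pp.
by apply: IH => Hs; apply: H => q [<-//|/Hs].
Qed.

(* Some relay strategy of the mixture does at least as well as the average. *)
Lemma decodable_half bsr bsd brd M N (c : code bsr bsd brd M) :
  valid_code c -> Perr N c <= / 3 ->
  exists (g : relay_strategy (nHD bsr bsd brd)) (G : {set 'I_M}),
    (M <= 2 * #|G|)%N /\ {in G &, injective (fun m => (run (enc c m) g N).2)}.
Proof.
move=> [w_ge0 sum_w] errc.
(* The decoder returns an element of ['I_M] on any input. *)
have M_gt0 : (0 < M)%N by case: (M) (dec c [::]) => // -[].
have rM_gt0 : 0 < INR M by apply/lt_0_INR/ltP.
pose ok (g : relay_strategy (nHD bsr bsd brd)) := [pred m | dec c (run (enc c m) g N).2 == m].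
(* If every strategy decoded fewer than half of the messages, the error would be at least 1/2, above
   the assumed 1/3. *)
have [p] : exists p : R * relay_strategy (nHD bsr bsd brd), ~~ (2 * #|ok p.2| < M)%N.
  apply: (@In_not_all _ (relay c)) => H.
  have := le_weighted_sum (X := INR M / 2)
    (e := fun m p => if dec c (run (enc c m) p.2 N).2 == m then 0 else 1) w_ge0.
  rewrite sum_w Rmult_1_r => K; move: errc; rewrite /Perr => errc.
  have {K} K : INR M / 2 <= \big[Rplus/0]_(m < M) \big[Rplus/0]_(p <- relay c)
      (p.1 * (if dec c (run (enc c m) p.2 N).2 == m then 0 else 1)).
    apply: K => p /H lt_p; rewrite (sum_indicator (ok p.2)).
    have e : (#|ok p.2| + #|[predC ok p.2]| = M)%N by rewrite cardC card_ord.
    have /leP/le_INR : (M <= 2 * #|[predC ok p.2]|)%N by lia.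
    rewrite mult_INR; change (INR 2) with 2 => le_M.
    by apply: (Rle_trans _ (INR #|[predC ok p.2]|)); [lra | exact: Rle_refl].
  have := Rmult_le_compat_l _ _ _ (Rlt_le _ _ (Rinv_0_lt_compat _ rM_gt0)) K.
  have -> : / INR M * (INR M / 2) = / 2 by field; lra.
  by lra.
rewrite -leqNgt => le_M; exists p.2, [set m in ok p.2]; rewrite cardsE; split=> //.
by move=> m m'; rewrite !inE => /eqP em /eqP em' e; rewrite -em -em' e.
Qed.

Lemma zero_error_code bsr bsd brd M N (g : relay_strategy (nHD bsr bsd brd))
    (en : 'I_M -> nat -> Sig (nHD bsr bsd brd)) :
  (0 < M)%N -> injective (fun m => (run (en m) g N).2) ->
  exists c : code bsr bsd brd M, valid_code c /\ Perr N c = 0.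
Proof.
move=> M_gt0 inj; pose de y := odflt (Ordinal M_gt0) [pick m | (run (en m) g N).2 == y].
have deK m : de (run (en m) g N).2 = m.
  by rewrite /de; case: pickP => [m' /eqP/inj//|/(_ m)]; rewrite eqxx.
exists (Code en [:: (1, g)] de); split; first split=> /=.
- by move=> p [<-|//] /=; lra.
- by rewrite big_seq1.
rewrite /Perr /= big1 ?Rmult_0_r // => m _.
by rewrite big_seq1 /= deK eqxx Rmult_0_r.
Qed.

(** * The converse bound *)

Lemma ln2_gt0 : 0 < ln 2.
Proof. by rewrite -ln_1; apply: ln_increasing; lra. Qed.

Lemma Rpower2_log2 x : 0 < x -> Rpower 2 (log2 x) = x.
Proof.
move=> x_gt0; rewrite /Rpower /log2 -[RHS]exp_ln //; congr exp.
by field; have := ln2_gt0; lra.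
Qed.

Lemma INR_expn m n : INR (m ^ n)%N = INR m ^ n.
Proof. by elim: n => [//|n IH]; rewrite expnS mult_INR IH. Qed.

Lemma Rpower2_INR n : Rpower 2 (INR n) = INR (2 ^ n)%N.
Proof. by rewrite Rpower_pow ?INR_expn //; lra. Qed.

Lemma INR_leq m n : (m <= n)%N -> INR m <= INR n.
Proof. by move/leP/le_INR. Qed.

Lemma linear_lt_Rpower2 delta : 0 < delta ->
  exists N1, forall N, (N1 <= N)%N -> INR (2 * N.+1) < Rpower 2 (INR N * delta).
Proof.
move=> delta_gt0; pose c := delta * ln 2.
have c_gt0 : 0 < c by apply: Rmult_lt_0_compat => //; exact: ln2_gt0.
(* From [exp y >= (1 + y / 2) ^ 2] with [y = N * c], the bound 16 makes the quadratic term exceed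
   [4 * N], which beats [2 * N.+1]. *)
have [N1 ltN1] := INR_unbounded (16 / (c * c)).
exists (maxn N1 1) => N; rewrite geq_max => /andP[/INR_leq leN1 /INR_leq le1N].
have {}le1N : 1 <= INR N by [].
rewrite /Rpower; set y := INR N * delta * ln 2.
have y_gt0 : 0 < y.
  by apply: Rmult_lt_0_compat; [apply: Rmult_lt_0_compat; lra | exact: ln2_gt0].
have -> : exp y = exp (y / 2) * exp (y / 2) by rewrite -exp_plus; congr exp; field.
have ey := exp_ineq1_le (y / 2).
have : (1 + y / 2) * (1 + y / 2) <= exp (y / 2) * exp (y / 2) by apply: Rmult_le_compat; lra.
have : 16 < INR N * (c * c).
  have h : 16 / (c * c) < INR N by lra.
  have cc : 0 < c * c by nra.
  have := Rmult_lt_compat_r _ _ _ cc h.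
  by have -> : 16 / (c * c) * (c * c) = 16 by field; lra.
have ey' : y = INR N * c by rewrite /y /c; ring.
rewrite mult_INR (S_INR N); change (INR 2) with 2 => h16 hexp.
have h : INR N * 16 < INR N * (INR N * (c * c)) by apply: Rmult_lt_compat_l; lra.
have e4 : (1 + y / 2) * (1 + y / 2) = 1 + y + INR N * (INR N * (c * c)) / 4.
  by rewrite ey'; field.
lra.
Qed.

(** The entropy in bits of the law on [L] symbols that gives mass [x] to one symbol and spreads the
    rest evenly; [x] stands for [1 - t] in [objective]. *)
Definition ent (L x : R) : R := xlog x 1 + xlog (1 - x) (L - 1).

Lemma objectiveE bsr bsd brd g : objective bsr bsd brd g =
  Rmin (ent (Lpar bsd brd) (Rmax (/ Lpar bsd brd) g)) (g * INR (bsr - bsd)).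
Proof.
rewrite /objective /theta_star /ent.
by have -> : 1 - (1 - Rmax (/ Lpar bsd brd) g) = Rmax (/ Lpar bsd brd) g by ring.
Qed.

Lemma entE L x : 0 < x < 1 ->
  ent L x = x * log2 (1 / x) + (1 - x) * log2 ((L - 1) / (1 - x)).
Proof. by move=> ltx; rewrite /ent /xlog; do 2!case: Req_EM_T => /= ?; lra. Qed.

Lemma ent1 L : ent L 1 = 0.
Proof.
rewrite /ent /xlog; do 2!case: Req_EM_T => /= ?; try lra.
by rewrite /log2 Rdiv_diag ?ln_1; lra.
Qed.

Lemma entV L : 1 < L -> ent L (/ L) = log2 L.
Proof.
move=> L_gt1; have VL : / L < 1 by rewrite -Rinv_1; apply: Rinv_lt_contravar; lra.
have VL0 : 0 < / L by apply: Rinv_0_lt_compat; lra.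
rewrite entE //; have -> : 1 / / L = L by field; lra.
have -> : (L - 1) / (1 - / L) = L by field; lra.
ring.
Qed.

Lemma ent_pow N k l : (0 < k <= N)%N -> (0 < l)%N ->
  Rpower 2 (INR N * ent (INR l.+1) (INR k / INR N)) * INR (k ^ k * (N - k) ^ (N - k)) =
  INR (N ^ N * l ^ (N - k)).
Proof.
move=> /andP[k_gt0 le_kN] l_gt0.
have rk : 0 < INR k by apply/lt_0_INR/ltP.
have rl : 0 < INR l by apply/lt_0_INR/ltP.
have rN : 0 < INR N by apply/lt_0_INR/ltP/(leq_trans k_gt0).
(* At [k = N] the convention of [xlog] at zero matches [0 ^ 0 = 1]. *)
have [eNk|ne_kN] := eqVneq k N.
  rewrite eNk subnn !expn0 !muln1 Rdiv_diag ?ent1 ?Rmult_0_r; last lra.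
  by rewrite Rpower_O ?Rmult_1_l //; lra.
have lt_kN : (k < N)%N by rewrite ltn_neqAle ne_kN.
have eNk : INR (N - k) = INR N - INR k by rewrite minus_INR //; apply/leP.
have rNk : 0 < INR N - INR k by rewrite -eNk; apply/lt_0_INR/ltP; rewrite subn_gt0.
rewrite entE; last first.
  split; first by apply: Rdiv_lt_0_compat.
  by apply: (Rmult_lt_reg_r (INR N)) => //; rewrite /Rdiv Rmult_assoc Rinv_l; lra.
rewrite S_INR /Rpower /log2.
have -> : 1 / (INR k / INR N) = INR N / INR k by field; lra.
have -> : (INR l + 1 - 1) / (1 - INR k / INR N) = INR l * INR N / INR (N - k).
  by rewrite eNk; field; lra.
set u := INR N / INR k; set v := INR l * INR N / INR (N - k).
have u_gt0 : 0 < u by apply: Rdiv_lt_0_compat.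
have v_gt0 : 0 < v.
  by apply: Rdiv_lt_0_compat; [apply: Rmult_lt_0_compat | rewrite eNk].
have -> : INR N * (INR k / INR N * (ln u / ln 2) + (1 - INR k / INR N) * (ln v / ln 2)) * ln 2
    = INR k * ln u + INR (N - k) * ln v.
  by rewrite eNk; field; have := ln2_gt0; lra.
rewrite exp_plus -/(Rpower u (INR k)) -/(Rpower v (INR (N - k))) !Rpower_pow //.
rewrite !mult_INR !INR_expn.
have -> : u ^ k * v ^ (N - k) * (INR k ^ k * INR (N - k) ^ (N - k))
   = (u * INR k) ^ k * (v * INR (N - k)) ^ (N - k) by rewrite !Rpow_mult_distr; ring.
have -> : u * INR k = INR N by rewrite /u; field; lra.
have -> : v * INR (N - k) = INR N * INR l by rewrite /v eNk; field; lra.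
rewrite Rpow_mult_distr -Rmult_assoc -pow_add; congr (_ ^ _ * _).
by rewrite plusE subnKC.
Qed.

Lemma Lpar_gt1 bsd brd : (bsd < brd)%N -> 1 < Lpar bsd brd.
Proof.
move=> lt; rewrite /Lpar; apply: (Rlt_le_trans _ (INR 2)); first by change (INR 2) with 2; lra.
by apply: INR_leq; rewrite -{1}(expn1 2) leq_exp2l // subn_gt0.
Qed.

(** If [k / N] is at least [1 / L], zero can be the likeliest symbol and the weighted count applies.
    Below that, the maximum is [1 / L], where [ent] is [log2 L] and the count of all words
    suffices. *)
Lemma card_words_le_Rpower bsd brd N k : (bsd < brd)%N -> (0 < N)%N -> (k <= N)%N ->
  INR #|words (brd - bsd) N k|
    <= Rpower 2 (INR N * ent (Lpar bsd brd) (Rmax (/ Lpar bsd brd) (INR k / INR N))).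
Proof.
move=> lt_b N_gt0 le_kN; have L1 := Lpar_gt1 lt_b; set L := Lpar bsd brd in L1 *.
have rN : 0 < INR N by apply/lt_0_INR/ltP.
have b_gt0 : (0 < brd - bsd)%N by rewrite subn_gt0.
have l_gt0 := predn_exp2_gt0 b_gt0.
have eL : L = INR (2 ^ (brd - bsd)).-1.+1 by rewrite prednK ?expn_gt0.
have [le_NkL|lt_kLN] := leqP N (k * 2 ^ (brd - bsd)).
  have k_gt0 : (0 < k)%N by case: (k) le_NkL => //; rewrite mul0n; lia.
  rewrite Rmax_right; last first.
    apply: (Rmult_le_reg_r (L * INR N)); first by apply: Rmult_lt_0_compat; lra.
    have -> : / L * (L * INR N) = INR N by field; lra.
    have -> : INR k / INR N * (L * INR N) = INR k * L by field; lra.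
    by have := INR_leq le_NkL; rewrite mult_INR.
  have P0 : 0 < INR (k ^ k * (N - k) ^ (N - k)).
    apply/lt_0_INR/ltP; rewrite muln_gt0 !expn_gt0 k_gt0 /=.
    by case: (N - k)%N.
  apply: (Rmult_le_reg_r _ _ _ P0); rewrite {1}eL ent_pow ?k_gt0 // -mult_INR.
  by apply: INR_leq; apply: card_words_le_entropy.
rewrite Rmax_left; last first.
  apply: (Rmult_le_reg_r (L * INR N)); first by apply: Rmult_lt_0_compat; lra.
  have -> : / L * (L * INR N) = INR N by field; lra.
  have -> : INR k / INR N * (L * INR N) = INR k * L by field; lra.
  by have := INR_leq (ltnW lt_kLN); rewrite mult_INR.
rewrite entV // Rmult_comm -Rpower_mult Rpower2_log2; last lra.
rewrite Rpower_pow; last lra.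
by rewrite -INR_expn; apply: INR_leq; rewrite -expnM card_words_le_all.
Qed.

Lemma block_card_le_objective bsr bsd brd N k : (bsd < brd)%N -> (0 < N)%N -> (k <= N)%N ->
  INR (block_card (bsr - bsd) (brd - bsd) N k)
    <= Rpower 2 (INR N * objective bsr bsd brd (INR k / INR N)).
Proof.
move=> lt_b N_gt0 le_kN; have rN : 0 < INR N by apply/lt_0_INR/ltP.
rewrite objectiveE /Rmin; case: Rle_dec => _.
  apply: Rle_trans (card_words_le_Rpower lt_b N_gt0 le_kN).
  by apply: INR_leq; apply: geq_minl.
have -> : INR N * (INR k / INR N * INR (bsr - bsd)) = INR ((bsr - bsd) * k).
  by rewrite mult_INR; field; lra.
by rewrite Rpower2_INR; apply: INR_leq; apply: geq_minr.
Qed.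

(** A rate above the bound would force an exponential factor below [2 * N.+1]: the 2 comes from
    keeping half of the messages, [N.+1] from the values of [k]. A general [c] also serves the
    degenerate case, with [c = 0]. *)
Lemma converse bsr bsd brd c :
  (forall N k, (0 < N)%N -> (k <= N)%N ->
     INR (block_card (bsr - bsd) (brd - bsd) N k) <= Rpower 2 (INR N * c)) ->
  forall Rt, achievable bsr bsd brd Rt -> Rt <= INR bsd + c.
Proof.
move=> le_c Rt achR; apply: Rnot_lt_le => lt_R.
have [N0 codes] := achR (/ 3) ltac:(lra).
have [N1 bigN] := @linear_lt_Rpower2 (Rt - (INR bsd + c)) ltac:(lra).
pose N := (N0 + N1).+1; have N_gt0 : (0 < N)%N by [].
have [|M [C [vC [le_M errC]]]] := codes N; first by rewrite /N; lia.
have lt_N := bigN N ltac:(rewrite /N; lia).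
have [g [G [le_MG inj_G]]] := decodable_half vC errC.
have [k le_kN le_G] := converse_count inj_G.
have {le_MG le_G} le_MB :
    (M <= 2 * N.+1 * (2 ^ (bsd * N) * block_card (bsr - bsd) (brd - bsd) N k))%N.
  by apply: leq_trans le_MG _; rewrite -mulnA leq_mul2l.
have le_K := le_c N k N_gt0 le_kN.
set K := block_card _ _ _ _ in le_MB le_K.
pose D := Rpower 2 (INR bsd * INR N).
have le_MK : INR M <= INR (2 * N.+1) * (D * INR K).
  by rewrite /D -mult_INR Rpower2_INR -!mult_INR; apply: INR_leq.
have D_gt0 : 0 < D by apply: exp_pos.
have N1_gt0 : 0 <= INR (2 * N.+1) by apply: pos_INR.
have H : Rpower 2 (INR N * Rt) <= INR (2 * N.+1) * (D * Rpower 2 (INR N * c)).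
  apply: Rle_trans le_M _; apply: Rle_trans le_MK _.
  by apply: Rmult_le_compat_l => //; apply: Rmult_le_compat_l => //; lra.
have {H} : Rpower 2 (INR N * Rt) < Rpower 2 (INR N * Rt).
  apply: Rle_lt_trans H _.
  have P : 0 < D * Rpower 2 (INR N * c) by apply: Rmult_lt_0_compat => //; apply: exp_pos.
  apply: Rlt_le_trans (Rmult_lt_compat_r _ _ _ P lt_N) _.
  by rewrite /D -!Rpower_plus; right; congr Rpower; ring.
lra.
Qed.

(** * Achievability *)

Lemma block_card_gt0 a b T k : (k <= T)%N -> (0 < block_card a b T k)%N.
Proof.
move=> le_kT; rewrite /block_card leq_min expn_gt0 andbT.
apply/card_gt0P; exists [ffun=> 0%R]; rewrite inE.
suff -> : [set i | [ffun=> 0%R] i == 0%R :> 'cV['F_2]_b] = [set: 'I_T].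
  by rewrite cardsT card_ord.
by apply/setP=> i; rewrite !inE ffunE eqxx.
Qed.

Lemma achievable_block bsr bsd brd T k r Rt : (0 < T)%N -> (k <= T)%N ->
  Rpower 2 (INR T * r) <= INR (block_card (bsr - bsd) (brd - bsd) T k) ->
  Rt < INR bsd + r -> achievable bsr bsd brd Rt.
Proof.
move=> T_gt0 le_kT le_r lt_Rt.
have rT : 0 < INR T by apply/lt_0_INR/ltP.
set K := block_card _ _ _ _ in le_r.
have K_gt0 : (0 < K)%N by apply: block_card_gt0.
(* Since [K] is at least 1, a negative [r] may be raised to 0. *)
wlog r_ge0 : r le_r lt_Rt / 0 <= r => [H|].
  have [r_ge0|r_lt0] := Rle_lt_dec 0 r; first exact: (H r).
  apply: (H 0); try lra.
  by rewrite Rmult_0_r Rpower_O; [apply: (INR_leq K_gt0) | lra].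
move=> eps eps_gt0; pose del := INR bsd + r - Rt.
have del_gt0 : 0 < del by rewrite /del; lra.
(* At most two blocks carry no word index, the first and an incomplete last one; this costs
   [2 * T * r] bits, to be covered by [N * del]. *)
have [N0 bigN] := INR_unbounded (2 * INR T * r / del).
exists (maxn N0 T) => N; rewrite geq_max => /andP[/INR_leq le_N0 le_TN].
pose B := (N %/ T).-1.
have divN : (0 < N %/ T)%N by rewrite divn_gt0.
have le_BN : (B.+1 * T <= N)%N by rewrite /B prednK // leq_trunc_div.
have lt_NB : (N <= B.+2 * T)%N by rewrite /B prednK // ltnW // ltn_ceil.
have [g [en inj]] := block_code bsr bsd brd T_gt0 le_kT le_BN.
have M_gt0 : (0 < 2 ^ (bsd * N) * K ^ B)%N by rewrite muln_gt0 !expn_gt0 K_gt0.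
have [c [vc err0]] := zero_error_code M_gt0 inj.
exists (2 ^ (bsd * N) * K ^ B)%N, c; split=> //; split; last by rewrite err0; lra.
rewrite mult_INR -Rpower2_INR INR_expn mult_INR.
apply: (Rle_trans _ (Rpower 2 (INR bsd * INR N) * Rpower 2 (INR T * r) ^ B)); last first.
  apply: Rmult_le_compat_l; first exact/Rlt_le/exp_pos.
  by apply: pow_incr; split; first exact/Rlt_le/exp_pos.
rewrite -(Rpower_pow B (Rpower 2 _)) ?Rpower_mult -?Rpower_plus; last exact: exp_pos.
apply: Rle_Rpower; first lra.
have := INR_leq lt_NB; rewrite mult_INR !S_INR => leNB.
have leNBr := Rmult_le_compat_r _ _ _ r_ge0 leNB.
have : 2 * INR T * r <= INR N * del.
  have h : 2 * INR T * r / del <= INR N by lra.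
  have := Rmult_le_compat_r _ _ _ (Rlt_le _ _ del_gt0) h.
  by have -> : 2 * INR T * r / del * del = 2 * INR T * r by field; lra.
by rewrite /del; lra.
Qed.

Lemma nat_floor x : 0 <= x -> exists k : nat, INR k <= x < INR k + 1.
Proof.
move=> x_ge0; have [n] := INR_unbounded x.
elim: n => [|n IH]; first by move=> /= ?; lra.
rewrite S_INR => lt_x; have [le_n|lt_n] := Rle_lt_dec (INR n) x; last exact: IH.
by exists n; lra.
Qed.

(** Inside the unit interval [ent] has a closed form without case distinctions, continuous as a
    combination of logarithms. *)
Lemma ent_continuous L m delta : 1 < L -> 0 < m < 1 -> 0 < delta ->
  exists2 eta, 0 < eta & forall x, Rabs (x - m) < eta -> ent L m - delta < ent L x.
Proof.
move=> L_gt1 lt_m delta_gt0.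
pose h x := - (x * ln x) - (1 - x) * ln (1 - x) + (1 - x) * ln (L - 1).
have entEh x : 0 < x < 1 -> ent L x = h x * / ln 2.
  move=> lt_x; rewrite entE // /h /log2 /Rdiv Rmult_1_l ln_Rinv; last lra.
  have V : 0 < / (1 - x) by apply: Rinv_0_lt_compat; lra.
  have -> : ln ((L - 1) * / (1 - x)) = ln (L - 1) - ln (1 - x).
    by rewrite ln_mult // ?ln_Rinv; lra.
  by field; have := ln2_gt0; lra.
have cont_id : continuity_pt (fun x => x) m.
  by apply: derivable_continuous_pt; exact: derivable_pt_id.
have cont_c c : continuity_pt (fun=> c) m by apply: continuity_pt_const.
have cont_1 : continuity_pt (fun x => 1 - x) m by apply: continuity_pt_minus.
have cont_ln y : 0 < y -> continuity_pt ln y.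
  by move=> y_gt0; apply: derivable_continuous_pt; exists (/ y); apply: derivable_pt_lim_ln.
have cont_h : continuity_pt (fun x => h x * / ln 2) m.
  apply: continuity_pt_mult => //; apply: continuity_pt_plus.
    apply: continuity_pt_minus; first apply: continuity_pt_opp.
      by apply: continuity_pt_mult => //; apply: cont_ln; lra.
    apply: continuity_pt_mult => //.
    by apply: (continuity_pt_comp (fun x => 1 - x) ln) => //; apply: cont_ln; lra.
  by apply: continuity_pt_mult.
have [eta [eta_gt0 near_m]] := cont_h delta delta_gt0.
exists (Rmin eta (Rmin m (1 - m))); first by apply: Rmin_glb_lt; [lra | apply: Rmin_glb_lt; lra].
move=> x lt_x.
have lt1 := Rlt_le_trans _ _ _ lt_x (Rmin_l _ _).
have lt2 := Rlt_le_trans _ _ _ lt_x (Rle_trans _ _ _ (Rmin_r _ _) (Rmin_l _ _)).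
have lt3 := Rlt_le_trans _ _ _ lt_x (Rle_trans _ _ _ (Rmin_r _ _) (Rmin_r _ _)).
have [] := Rabs_def2 _ _ lt2; have [] := Rabs_def2 _ _ lt3 => *.
rewrite !entEh; try lra.
have [->|ne_xm] := Req_dec x m; first lra.
have := near_m x (conj (conj I (not_eq_sym ne_xm)) lt1).
by rewrite /= /R_dist => /Rabs_def2[]; lra.
Qed.

Lemma Rpower2_ent_le_card_words bsd brd T k : (bsd < brd)%N -> (0 < k <= T)%N ->
  Rpower 2 (INR T * ent (Lpar bsd brd) (INR k / INR T)) <= INR T.+1 * INR #|words (brd - bsd) T k|.
Proof.
move=> lt_b /andP[k_gt0 le_kT].
have l_gt0 : (0 < (2 ^ (brd - bsd)).-1)%N by rewrite predn_exp2_gt0 // subn_gt0.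
have eL : Lpar bsd brd = INR (2 ^ (brd - bsd)).-1.+1 by rewrite prednK ?expn_gt0.
have P0 : 0 < INR (k ^ k * (T - k) ^ (T - k)).
  apply/lt_0_INR/ltP; rewrite muln_gt0 !expn_gt0 k_gt0 /=.
  by case: (T - k)%N.
apply: (Rmult_le_reg_r _ _ _ P0); rewrite eL ent_pow ?k_gt0 // Rmult_assoc -!mult_INR.
by apply: INR_leq; apply: card_words_ge.
Qed.

Lemma exists_good_block bsr bsd brd g delta : (bsd < brd)%N -> 0 <= g <= 1 -> 0 < delta ->
  exists T k, [/\ (0 < T)%N, (k <= T)%N &
    Rpower 2 (INR T * (objective bsr bsd brd g - delta))
      <= INR (block_card (bsr - bsd) (brd - bsd) T k)].
Proof.
move=> lt_b lt_g delta_gt0; rewrite objectiveE; have L1 := Lpar_gt1 lt_b.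
set L := Lpar bsd brd in L1 *; set m := Rmax (/ L) g; set a := (bsr - bsd)%N.
have VL0 : 0 < / L by apply: Rinv_0_lt_compat; lra.
have VL1 : / L < 1 by rewrite -Rinv_1; apply: Rinv_lt_contravar; lra.
have m_gt0 : 0 < m by apply: Rlt_le_trans VL0 (Rmax_l _ _).
have le_gm : g <= m by apply: Rmax_r.
have le_m1 : m <= 1 by apply: Rmax_lub; lra.
have a_ge0 : 0 <= INR a by apply: pos_INR.
(* At [m = 1] the entropy vanishes, so the objective is at most 0 and a block with a single word
   suffices. *)
have [m1|lt_m1] : m = 1 \/ m < 1 by lra.
  exists 1%N, 1%N; split=> //.
  apply: (Rle_trans _ 1); last by apply: (@INR_leq 1); apply: block_card_gt0.
  rewrite -(Rpower_O 2); last lra.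
  by apply: Rle_Rpower; first lra; rewrite m1 ent1; have := Rmin_l 0 (g * INR a); rewrite /=; lra.
have [eta eta_gt0 near_m] := @ent_continuous L m (delta / 2) L1 ltac:(lra) ltac:(lra).
have [N1 bigT1] := @linear_lt_Rpower2 (delta / 2) ltac:(lra).
have [N2 bigT2] := INR_unbounded (/ eta).
have [N3 bigT3] := INR_unbounded (/ m).
have [N4 bigT4] := INR_unbounded (INR a / delta).
(* In order, the four bounds absorb the factor [T.+1], bring [k / T] within [eta] of [m], make [k]
   positive, and cover the [a] bits lost by rounding [T * m] down to [k]. *)
pose T := (N1 + N2 + N3 + N4).+1; have T_gt0 : (0 < T)%N by [].
have rT : 0 < INR T by apply/lt_0_INR/ltP.
have /INR_leq leT2 : (N2 <= T)%N by rewrite /T; lia.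
have /INR_leq leT3 : (N3 <= T)%N by rewrite /T; lia.
have /INR_leq leT4 : (N4 <= T)%N by rewrite /T; lia.
have {}bigT1 := bigT1 T ltac:(rewrite /T; lia).
have inv_lt x y : 0 < x -> y / x < INR T -> y < INR T * x.
  move=> x_gt0 lt_y; have := Rmult_lt_compat_r _ _ _ x_gt0 lt_y.
  by have -> : y / x * x = y by field; lra.
have eta_T : 1 < INR T * eta by apply: inv_lt => //; rewrite /Rdiv Rmult_1_l; lra.
have m_T : 1 < INR T * m by apply: inv_lt => //; rewrite /Rdiv Rmult_1_l; lra.
have a_T : INR a < INR T * delta by apply: inv_lt => //; lra.
have [k [le_k lt_k]] := @nat_floor (INR T * m) ltac:(lra).
have k_gt0 : (0 < k)%N by apply/ltP/INR_lt => /=; lra.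
have le_kT : (k <= T)%N.
  apply/leP/INR_le; have := Rmult_lt_compat_l _ _ _ rT lt_m1; lra.
exists T, k; split=> //.
have ekT : INR k = INR T * (INR k / INR T) by field; lra.
have near_k : Rabs (INR k / INR T - m) < eta.
  by apply: Rabs_def1; apply: (Rmult_lt_reg_l (INR T)) => //; lra.
set obj := Rmin _ _.
have le_obj1 : obj <= ent L m by apply: Rmin_l.
have le_obj2 : obj <= g * INR a by apply: Rmin_r.
have le_words : Rpower 2 (INR T * (obj - delta)) <= INR #|words (brd - bsd) T k|.
  have lt_ent := near_m _ near_k.
  have le1 := @Rpower2_ent_le_card_words bsd brd T k lt_b ltac:(by rewrite k_gt0).
  have T1 : 0 < INR T.+1 by apply/lt_0_INR/ltP.
  apply: (Rmult_le_reg_l _ _ _ T1); apply: Rle_trans le1.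
  have le2 : INR T.+1 <= Rpower 2 (INR T * (delta / 2)).
    by have := bigT1; rewrite mult_INR; change (INR 2) with 2; lra.
  apply: Rle_trans (Rmult_le_compat_r _ _ _ (Rlt_le _ _ (exp_pos _)) le2) _.
  rewrite -Rpower_plus -Rmult_plus_distr_l; apply: Rle_Rpower; first lra.
  by apply: Rmult_le_compat_l; rewrite -/L; lra.
have le_bits : Rpower 2 (INR T * (obj - delta)) <= INR (2 ^ (a * k)).
  rewrite -Rpower2_INR; apply: Rle_Rpower; first lra.
  rewrite mult_INR.
  have h1 : INR T * obj <= INR T * (g * INR a) by apply: Rmult_le_compat_l; lra.
  have h2 : (INR T * g) * INR a <= (INR k + 1) * INR a.
    apply: Rmult_le_compat_r => //.
    by have := Rmult_le_compat_l _ _ _ (Rlt_le _ _ rT) le_gm; lra.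
  lra.
by rewrite /block_card /minn; case: ifP.
Qed.

(** Either the relay hears nothing beyond what the destination sees, or its alphabet has one symbol;
    it then adds no rate. *)
Lemma block_card_le1 a b T k : (a == 0)%N || (b == 0)%N -> (block_card a b T k <= 1)%N.
Proof.
case/orP=> /eqP->; first by rewrite /block_card mul0n geq_minr.
by apply: leq_trans (geq_minl _ _) (card_words_le_all 0 T k).
Qed.

Theorem theorem2 (bsr bsd brd : nat) :
  if (bsd < bsr)%N && (bsd < brd)%N then
    forall c : R,
      is_lub (fun v => exists g : R, 0 <= g <= 1 /\ v = objective bsr bsd brd g) c ->
      is_lub (achievable bsr bsd brd) (INR bsd + c)
  else is_lub (achievable bsr bsd brd) (INR bsd).
Proof.
case: ifP => [/andP[_ lt_b] c [ub_c least_c]|deg].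
  split; first apply: converse => N k N_gt0 le_kN.
    apply: Rle_trans (block_card_le_objective bsr lt_b N_gt0 le_kN) _.
    have rN : 0 < INR N by apply/lt_0_INR/ltP.
    apply: Rle_Rpower; first lra.
    apply: Rmult_le_compat_l; first lra.
    (* The parameter of the objective is the fraction of listening slots. *)
    apply: ub_c; exists (INR k / INR N); split=> //; split.
      by apply: Rmult_le_pos; [apply: pos_INR | apply/Rlt_le/Rinv_0_lt_compat].
    apply: (Rmult_le_reg_r (INR N)) => //; rewrite /Rdiv Rmult_assoc Rinv_l; last lra.
    by have := INR_leq le_kN; lra.
  move=> ub ub_ach; suff : c <= ub - INR bsd by lra.
  apply: least_c => _ [g [lt_g ->]]; apply: Rnot_lt_le => lt_ub.
  (* A third of the gap: after losing [d] in the block, the rate [ub + d] is still attained and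
     contradicts [ub]. *)
  pose d := (objective bsr bsd brd g - (ub - INR bsd)) / 3.
  have d_gt0 : 0 < d by rewrite /d; lra.
  have [T [k [T_gt0 le_kT le_K]]] := exists_good_block bsr lt_b lt_g d_gt0.
  have := ub_ach _ (@achievable_block _ _ _ _ _ _ (ub + d) T_gt0 le_kT le_K ltac:(rewrite /d; lra)).
  lra.
split.
  move=> Rt achR; rewrite -(Rplus_0_r (INR bsd)); apply: converse achR => N k _ _.
  rewrite Rmult_0_r Rpower_O; last lra.
  apply: (@INR_leq _ 1); apply: block_card_le1.
  by rewrite !subn_eq0; move/negbT: deg; rewrite negb_and -!leqNgt.
move=> ub ub_ach; apply: Rnot_lt_le => lt_ub.
(* The direct link alone, with [r = 0], reaches the midpoint between [ub] and [bsd]. *)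
have := ub_ach _ (@achievable_block bsr bsd brd 1 0 0 ((ub + INR bsd) / 2) isT isT _ ltac:(lra)).
rewrite Rmult_0_r Rpower_O; last lra.
by move=> H; have := H (@INR_leq 1 _ (@block_card_gt0 _ _ 1 0 isT)); lra.
Qed.
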